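(* Let $G$ be a Dedekind $\sigma$-complete $\ell$-group with weak unit $1$. Then there exist a set $X$, a $\sigma$-ideal $\mathcal{I}$ of subsets of $X$ and an injective $\sigma$-continuous $\ell$-homomorphism $\iota\colon G\hookrightarrow\frac{\mathbb{R}^X}{\mathcal{I}}$ such that $\iota(1)=[1]_{\mathcal{I}}$.
   Context: An $\ell$-group is a lattice-ordered group; a Dedekind $\sigma$-complete $\ell$-group is automatically archimedean, hence abelian. A poset is Dedekind $\sigma$-complete if every nonempty countable subset that has an upper bound has a supremum. An element $1$ of an abelian $\ell$-group $G$ is a weak unit if $1\geq0$ and, for every $f\in G$, $f\land1=0$ implies $f=0$. A map between posets is $\sigma$-continuous if it preserves all existing suprema of nonempty countable subsets. An $\ell$-homomorphism is a group homomorphism that is a lattice homomorphism. A $\sigma$-ideal of subsets of $X$ is a set $\mathcal{I}$ of subsets of $X$ containing $\emptyset$, closed under taking subsets and under countable unions ($X\in\mathcal{I}$ is allowed). $\frac{\mathbb{R}^X}{\mathcal{I}}$ is the quotient of $\mathbb{R}^X$ by the relation $f\sim g$ iff $\{x\in X\mid f(x)\neq g(x)\}\in\mathcal{I}$, with operations (and order) induced from the pointwise ones; $[f]_{\mathcal{I}}$ is the class of $f$, and $[1]_{\mathcal{I}}$ is the class of the constant function $1$. *)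

(* Defs.v *)
From HB Require Import structures.
From mathcomp Require Import all_boot all_order all_algebra.
From mathcomp Require Import all_classical reals.

Set Implicit Arguments.
Unset Strict Implicit.
Unset Printing Implicit Defensive.

Import Order.TTheory GRing.Theory Num.Theory.

Local Open Scope classical_set_scope.
Local Open Scope quotient_scope.
Local Open Scope ring_scope.

(* Groups are not assumed abelian, so the group law is the multiplicative one
   of groupType: x + y, 0 and - x are written (x * y)%g, 1%g and (x^-1)%g.
   In particular 1%g is the neutral element, not the weak unit. *)
HB.mixin Record isLGroup (d : Order.disp_t) G of Group G & Order.Lattice d G := {
  lgroup_le2l : forall z x y : G, (x <= y)%O -> ((z * x)%g <= (z * y)%g)%O;
  lgroup_le2r : forall z x y : G, (x <= y)%O -> ((x * z)%g <= (y * z)%g)%O }.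

#[short(type="lgroupType")]
HB.structure Definition LGroup (d : Order.disp_t) :=
  {G of isLGroup d G & Group G & Order.Lattice d G}.

Definition dedekind_sigma_complete d (T : porderType d) :=
  forall A : set T, countable A -> A !=set0 -> has_ubound A ->
    exists s, isLub A s.

Definition sigma_continuous d d' (S : porderType d) (T : porderType d')
    (f : S -> T) :=
  forall (A : set S) (s : S), countable A -> A !=set0 ->
    isLub A s -> isLub (f @` A) (f s).

Definition weak_unit d (G : lgroupType d) (u : G) :=
  (1%g <= u)%O /\ forall f : G, (f `&` u)%O = 1%g -> f = 1%g.

Definition lgroup_morphism d d' (G : lgroupType d) (H : lgroupType d')
    (f : G -> H) :=
  [/\ {morph f : x y / (x * y)%g >-> (x * y)%g},
      Order.meet_morphism f & Order.join_morphism f].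

Record sigma_ideal (X : Type) := SigmaIdeal {
  sigma_ideal_sets :> set X -> Prop;
  sigma_ideal0 : sigma_ideal_sets set0;
  sigma_idealS : forall A B, A `<=` B ->
    sigma_ideal_sets B -> sigma_ideal_sets A;
  sigma_ideal_bigcup : forall F : nat -> set X,
    (forall n, sigma_ideal_sets (F n)) -> sigma_ideal_sets (\bigcup_n F n) }.

Section RealQuotient.
Variables (R : realType) (X : Type) (I : sigma_ideal X).
Implicit Types f g h : X -> R.

Lemma sigma_idealU A B : I A -> I B -> I (A `|` B).
Proof.
move=> IA IB; rewrite -bigcup2E; apply: sigma_ideal_bigcup => -[|[|n]] //=.
exact: sigma_ideal0.
Qed.

Definition ideal_eq f g := `[< I [set x | f x <> g x] >].

Lemma ideal_eq_refl : reflexive ideal_eq.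
Proof.
by move=> f; apply/asboolP; apply: sigma_idealS (sigma_ideal0 I) => x /=.
Qed.

Lemma ideal_eq_sym : symmetric ideal_eq.
Proof.
move=> f g; apply/asboolP/asboolP; apply: sigma_idealS => x /= fg gf;
  exact: fg.
Qed.

Lemma ideal_eq_trans : transitive ideal_eq.
Proof.
move=> g f h /asboolP fg /asboolP gh; apply/asboolP.
apply: sigma_idealS (sigma_idealU fg gh) => x /= fh.
by have [fgx|] := pselect (f x = g x); [right; rewrite -fgx|left].
Qed.

Canonical ideal_eq_equiv :=
  EquivRel ideal_eq ideal_eq_refl ideal_eq_sym ideal_eq_trans.

Definition real_quotient := {eq_quot ideal_eq}.
HB.instance Definition _ := Choice.on real_quotient.
HB.instance Definition _ := EqQuotient.on real_quotient.
Local Notation Q := real_quotient.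
Implicit Types a b c : Q.

Definition ideal_le f g := `[< I [set x | ~ (f x <= g x)] >].

Definition quot_mul := lift_op2 Q (fun f g => f + g).
Definition quot_one : Q := \pi_Q 0.
Definition quot_inv := lift_op1 Q (fun f => - f).
Definition quot_meet := lift_op2 Q (fun f g => (f `&` g)%O).
Definition quot_join := lift_op2 Q (fun f g => (f `|` g)%O).
Definition quot_le := lift_fun2 Q ideal_le.

Lemma ideal_eqW f g f' g' (P : set X) : ideal_eq f f' -> ideal_eq g g' ->
  (forall x, P x -> f x = f' x -> g x = g' x -> False) -> I P.
Proof.
move=> /asboolP ff' /asboolP gg' PE.
apply: sigma_idealS (sigma_idealU ff' gg') => x /= Px.
have [fx|] := pselect (f x = f' x); last by left.
have [gx|] := pselect (g x = g' x); last by right.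
by case: (PE x).
Qed.

Lemma pi_eqE f g : (\pi_Q f == \pi_Q g) = ideal_eq f g.
Proof. exact: (eqmodE ideal_eq_equiv). Qed.

Lemma repr_ideal_eq f : ideal_eq (repr (\pi_Q f)) f.
Proof. by rewrite -pi_eqE reprK. Qed.

Lemma pi_quot_mul : {morph \pi_Q : f g / f + g >-> quot_mul f g}.
Proof.
move=> f g; unlock quot_mul; apply/eqP; rewrite pi_eqE ideal_eq_sym.
apply/asboolP; apply: (ideal_eqW (repr_ideal_eq f) (repr_ideal_eq g)).
by move=> x /= + fx gx; apply; rewrite !fctE fx gx.
Qed.

Lemma pi_quot_inv : {morph \pi_Q : f / - f >-> quot_inv f}.
Proof.
move=> f; unlock quot_inv; apply/eqP; rewrite pi_eqE ideal_eq_sym.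
apply/asboolP; apply: (ideal_eqW (repr_ideal_eq f) (repr_ideal_eq f)).
by move=> x /= + fx _; apply; rewrite !fctE fx.
Qed.

Lemma pi_quot_meet :
  {morph \pi_Q : f g / (f `&` g)%O >-> quot_meet f g}.
Proof.
move=> f g; unlock quot_meet; apply/eqP; rewrite pi_eqE ideal_eq_sym.
apply/asboolP; apply: (ideal_eqW (repr_ideal_eq f) (repr_ideal_eq g)).
by move=> x /= + fx gx; apply; rewrite !meetfE fx gx.
Qed.

Lemma pi_quot_join :
  {morph \pi_Q : f g / (f `|` g)%O >-> quot_join f g}.
Proof.
move=> f g; unlock quot_join; apply/eqP; rewrite pi_eqE ideal_eq_sym.
apply/asboolP; apply: (ideal_eqW (repr_ideal_eq f) (repr_ideal_eq g)).
by move=> x /= + fx gx; apply; rewrite !joinfE fx gx.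
Qed.

Lemma ideal_leE f g : ideal_le f g = ideal_eq (f `&` g)%O f.
Proof.
by congr asbool; congr (I _); apply/seteqP; split=> x /= + H; apply;
  move: H; rewrite meetfE leEmeet => /eqP.
Qed.

Lemma quot_leE a b : quot_le a b = (quot_meet a b == a).
Proof.
unlock quot_le quot_meet; rewrite ideal_leE -pi_eqE.
by rewrite reprK.
Qed.

Lemma pi_quot_le : {mono \pi_Q : f g / ideal_le f g >-> quot_le f g}.
Proof.
by move=> f g; rewrite quot_leE -pi_quot_meet ideal_leE -pi_eqE.
Qed.

Lemma quot_mulA : associative quot_mul.
Proof.
by elim/quotW=> f; elim/quotW=> g; elim/quotW=> h; rewrite -!pi_quot_mul addrA.
Qed.

Lemma quot_mul1 : left_id quot_one quot_mul.
Proof. by elim/quotW=> f; rewrite -pi_quot_mul add0r. Qed.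

Lemma quot_mulr1 : right_id quot_one quot_mul.
Proof. by elim/quotW=> f; rewrite -pi_quot_mul addr0. Qed.

Lemma quot_mulV : left_inverse quot_one quot_inv quot_mul.
Proof. by elim/quotW=> f; rewrite -pi_quot_inv -pi_quot_mul addNr. Qed.

Lemma quot_mulrV : right_inverse quot_one quot_inv quot_mul.
Proof. by elim/quotW=> f; rewrite -pi_quot_inv -pi_quot_mul subrr. Qed.

(* The (commutative) group law of the quotient is induced by addition. *)
HB.instance Definition _ :=
  isGroup.Build Q quot_mulA quot_mul1 quot_mulr1 quot_mulV quot_mulrV.

Lemma quot_meetC : commutative quot_meet.
Proof.
by elim/quotW=> f; elim/quotW=> g; rewrite -!pi_quot_meet meetC.
Qed.

Lemma quot_joinC : commutative quot_join.
Proof.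
by elim/quotW=> f; elim/quotW=> g; rewrite -!pi_quot_join joinC.
Qed.

Lemma quot_meetA : associative quot_meet.
Proof.
by elim/quotW=> f; elim/quotW=> g; elim/quotW=> h; rewrite -!pi_quot_meet meetA.
Qed.

Lemma quot_joinA : associative quot_join.
Proof.
by elim/quotW=> f; elim/quotW=> g; elim/quotW=> h; rewrite -!pi_quot_join joinA.
Qed.

Lemma quot_joinKI b a : quot_meet a (quot_join a b) = a.
Proof.
elim/quotW: a => f; elim/quotW: b => g.
by rewrite -pi_quot_join -pi_quot_meet joinKI.
Qed.

Lemma quot_meetKU b a : quot_join a (quot_meet a b) = a.
Proof.
elim/quotW: a => f; elim/quotW: b => g.
by rewrite -pi_quot_meet -pi_quot_join meetKU.
Qed.

Lemma quot_le_refl : reflexive quot_le.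
Proof. by elim/quotW=> f; rewrite quot_leE -pi_quot_meet meetxx eqxx. Qed.

Lemma quot_le_anti : antisymmetric quot_le.
Proof.
move=> a b; rewrite !quot_leE => /andP[/eqP ab /eqP ba].
by rewrite -ab quot_meetC.
Qed.

Lemma quot_le_trans : transitive quot_le.
Proof.
move=> b a c; rewrite !quot_leE => /eqP ab /eqP bc.
by rewrite -ab -quot_meetA bc.
Qed.

Fact real_quotient_display : Order.disp_t.
Proof. exact: Order.default_display. Qed.

HB.instance Definition _ := Order.Le_isPOrder.Build real_quotient_display Q
  quot_le_refl quot_le_anti quot_le_trans.
HB.instance Definition _ :=
  Order.POrder_isLattice.Build real_quotient_display Q
    quot_meetC quot_joinC quot_meetA quot_joinA quot_joinKI quot_meetKU
    quot_leE.

Lemma real_quotient_mulE a b : (a * b)%g = quot_mul a b. Proof. by []. Qed.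
Lemma real_quotient_leE a b : (a <= b)%O = quot_le a b. Proof. by []. Qed.

Lemma quot_le2l c a b : (a <= b)%O -> ((c * a)%g <= (c * b)%g)%O.
Proof.
rewrite -[a]reprK -[b]reprK -[c]reprK.
rewrite !real_quotient_leE !real_quotient_mulE -!pi_quot_mul !pi_quot_le.
move=> /asboolP fg; apply/asboolP; apply: sigma_idealS fg => x /=.
by rewrite !fctE lerD2l.
Qed.

Lemma quot_le2r c a b : (a <= b)%O -> ((a * c)%g <= (b * c)%g)%O.
Proof.
rewrite -[a]reprK -[b]reprK -[c]reprK.
rewrite !real_quotient_leE !real_quotient_mulE -!pi_quot_mul !pi_quot_le.
move=> /asboolP fg; apply/asboolP; apply: sigma_idealS fg => x /=.
by rewrite !fctE lerD2r.
Qed.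

HB.instance Definition _ :=
  isLGroup.Build real_quotient_display Q quot_le2l quot_le2r.

Lemma pi_eqP f g : \pi_Q f = \pi_Q g <-> I [set x | f x <> g x].
Proof.
split=> [/eqP|fg]; first by rewrite pi_eqE => /asboolP.
by apply/eqP; rewrite pi_eqE; apply/asboolP.
Qed.

Lemma pi_leP f g : (\pi_Q f <= \pi_Q g)%O <-> I [set x | ~ (f x <= g x)].
Proof. by rewrite real_quotient_leE pi_quot_le; split=> /asboolP. Qed.

Lemma pi_mul f g : \pi_Q (f + g) = (\pi_Q f * \pi_Q g)%g.
Proof. exact: pi_quot_mul. Qed.

Lemma pi_one : \pi_Q 0 = 1%g.
Proof. by []. Qed.

Lemma pi_meet f g :
  \pi_Q (fun x => Num.min (f x) (g x)) = (\pi_Q f `&` \pi_Q g)%O.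
Proof.
transitivity (\pi_Q (f `&` g)%O); last exact: pi_quot_meet.
by congr (\pi_Q _); apply/funext => x; rewrite meetfE meetEtotal.
Qed.

Lemma pi_join f g :
  \pi_Q (fun x => Num.max (f x) (g x)) = (\pi_Q f `|` \pi_Q g)%O.
Proof.
transitivity (\pi_Q (f `|` g)%O); last exact: pi_quot_join.
by congr (\pi_Q _); apply/funext => x; rewrite joinfE joinEtotal.
Qed.

End RealQuotient.

(* Main.v *)
Require Import Defs.
From mathcomp Require Import all_boot all_order all_algebra.
From mathcomp Require Import all_classical reals.
From mathcomp Require Import ring lra.

(* Let [X] be the set of all functions [x : G -> R], and call a set of such
   functions null if countably many instances of the wanted identities
   ([x u = 1], [x (f * g) = x f + x g], preservation of meets, joins and of
   suprema of sequences) exclude all its elements. Then [f |-> [x |-> x f]] has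
   all the required properties for free, except injectivity, which says that
   countably many such instances together with [x c <> 0] can be satisfied for
   every [c > 1].

   This is a Rasiowa-Sikorski (generic filter) argument. The conditions are the
   elements [p > 1], and [p] forces [f <= g] when [(f * g^-1)^+] is disjoint
   from [p]. In an archimedean l-group polars are normal, so forcing is
   compatible with multiplication on both sides without knowing that [G] is
   commutative. Using the archimedean property and the weak unit, it is dense
   to decide [f <= g], to bound [f] by a power of [u], and, for [s = sup A], to
   find [a] in [A] with [(s * a^-1) ^+ (2 ^ j) <= u]. A decreasing sequence
   meeting countably many such dense sets induces on a countable sub-l-group a
   total preorder in which [u] is a strong unit; Hoelder's construction
   [x f = sup {m / k | u ^ m <= f ^ k}] yields the function sought. *)

Set Implicit Arguments.
Unset Strict Implicit.
Unset Printing Implicit Defensive.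

Import Order.TTheory GRing.Theory Num.Theory.

(** * Forcing in archimedean l-groups *)

Section LGroupTheory.
Context (d : Order.disp_t) (G : lgroupType d).
Implicit Types a b c f g p q s t u x y z : G.
Local Open Scope classical_set_scope.
Local Open Scope order_scope.
Local Open Scope group_scope.

(** * Order arithmetic: translations, inverses and conjugation *)

Lemma lgroup_leM x y z t : x <= y -> z <= t -> x * z <= y * t.
Proof.
by move=> xy zt; exact: le_trans (lgroup_le2r _ _ _ xy) (lgroup_le2l _ _ _ zt).
Qed.

Lemma lgroup_leMx x y : 1 <= x -> 1 <= y -> 1 <= x * y.
Proof. by move=> x1 y1; rewrite -[leLHS]mulg1 lgroup_leM. Qed.

Lemma lgroup_leX x y n : x <= y -> x ^+ n <= y ^+ n.
Proof.
by move=> xy; elim: n => [|n IH]; rewrite ?expg0// !expgS lgroup_leM.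
Qed.

Lemma lgroup_le1X x n : 1 <= x -> 1 <= x ^+ n.
Proof. by move=> /(lgroup_leX n); rewrite expg1n. Qed.

Lemma lgroup_leVl x y z : (x * y <= z) = (y <= x^-1 * z).
Proof.
by apply/idP/idP => [/(lgroup_le2l x^-1)|/(lgroup_le2l x)];
  rewrite ?mulKg ?mulVKg.
Qed.

Lemma lgroup_leVr x y z : (x * y <= z) = (x <= z * y^-1).
Proof.
by apply/idP/idP => [/(lgroup_le2r y^-1)|/(lgroup_le2r y)];
  rewrite ?mulgK ?mulgVK.
Qed.

Lemma lgroup_divle1 x y : (x * y^-1 <= 1) = (x <= y).
Proof. by rewrite lgroup_leVr invgK mul1g. Qed.

Lemma lgroup_div1le x y : (1 <= x * y^-1) = (y <= x).
Proof. by rewrite -lgroup_leVr mul1g. Qed.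

Lemma lgroup_leV x y : (x^-1 <= y^-1) = (y <= x).
Proof. by rewrite -[y^-1]mulg1 -lgroup_leVl lgroup_divle1. Qed.

Lemma lgroup_leV1 x : (x^-1 <= 1) = (1 <= x).
Proof. by rewrite -[X in _ <= X]invg1 lgroup_leV. Qed.

Lemma mulg_joinr z : {morph *%g z : x y / x `|` y}.
Proof.
move=> x y; apply: le_anti; rewrite leUx !lgroup_le2l ?leUl ?leUr// andbT.
by rewrite lgroup_leVl leUx -!lgroup_leVl leUl leUr.
Qed.

Lemma mulg_joinl z : {morph *%g^~ z : x y / x `|` y}.
Proof.
move=> x y /=; apply: le_anti; rewrite leUx !lgroup_le2r ?leUl ?leUr// andbT.
by rewrite lgroup_leVr leUx -!lgroup_leVr leUl leUr.
Qed.

Lemma invg_join x y : (x `|` y)^-1 = x^-1 `&` y^-1.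
Proof.
apply: le_anti; rewrite lexI !lgroup_leV leUl leUr/=.
by rewrite -lgroup_leV invgK leUx -lgroup_leV invgK leIl -lgroup_leV invgK leIr.
Qed.

Lemma invg_meet x y : (x `&` y)^-1 = x^-1 `|` y^-1.
Proof. by rewrite -[RHS]invgK invg_join !invgK. Qed.

Lemma mulg_meetr z : {morph *%g z : x y / x `&` y}.
Proof.
move=> x y; apply: le_anti; rewrite lexI !lgroup_le2l ?leIl ?leIr//=.
rewrite -[X in X <= _](mulVKg z) lgroup_le2l//.
rewrite lexI -[X in _ <= X](mulKg z) lgroup_le2l ?leIl//.
by rewrite -[X in _ <= X](mulKg z) lgroup_le2l ?leIr.
Qed.

Lemma mulg_meetl z : {morph *%g^~ z : x y / x `&` y}.
Proof.
move=> x y /=; apply: invg_inj.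
by rewrite invgM !invg_meet !invgM mulg_joinr.
Qed.

Lemma conjg_le x y z : x <= y -> x ^ z <= y ^ z.
Proof. by move=> xy; rewrite !conjgE lgroup_le2l// lgroup_le2r. Qed.

Lemma conjg_join z : {morph conjg^~ z : x y / x `|` y}.
Proof. by move=> x y; rewrite /= !conjgE mulg_joinl mulg_joinr. Qed.

Lemma conjg_meet z : {morph conjg^~ z : x y / x `&` y}.
Proof. by move=> x y; rewrite /= !conjgE mulg_meetl mulg_meetr. Qed.

Lemma conjg_ge1 x z : 1 <= x -> 1 <= x ^ z.
Proof. by move=> /(conjg_le z); rewrite conj1g. Qed.

(** Expanding the right-hand side gives the meet of [x * x], [y * x], [x * z] and [y * z]; the first
    three are above [x]. *)
Lemma meet_mul_le x y z : 1 <= x -> 1 <= y -> 1 <= z ->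
  x `&` (y * z) <= (x `&` y) * (x `&` z).
Proof.
move=> x1 y1 z1; rewrite mulg_meetr !mulg_meetl !lexI.
rewrite leIr !andbT !(le_trans (leIl x (y * z)))//.
- by rewrite -[X in X <= _]mulg1 lgroup_leM.
- by rewrite -[X in X <= _]mul1g lgroup_leM.
- by rewrite -[X in X <= _]mulg1 lgroup_leM.
Qed.

Lemma disjointM x y z : 1 <= x -> 1 <= y -> 1 <= z ->
  y `&` x = 1 -> z `&` x = 1 -> (y * z) `&` x = 1.
Proof.
move=> x1 y1 z1 yx zx; apply: le_anti; rewrite lexI x1 lgroup_leMx// !andbT.
rewrite meetC; apply: le_trans (meet_mul_le _ _ _) _ => //.
by rewrite !(meetC x) yx zx mulg1.
Qed.

Lemma disjointX x y n : 1 <= x -> 1 <= y -> y `&` x = 1 -> y ^+ n `&` x = 1.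
Proof.
move=> x1 y1 yx; elim: n => [|n IH]; first by rewrite expg0; exact/meet_l.
by rewrite expgS; apply: disjointM => //; exact: lgroup_le1X.
Qed.

Lemma disjointS x y z : 1 <= x -> 1 <= y -> y <= z -> z `&` x = 1 ->
  y `&` x = 1.
Proof.
move=> x1 y1 yz zx; apply: le_anti; rewrite lexI x1 y1 !andbT -zx.
exact: leI2.
Qed.

(** The positive part of [x] is [x] times that of [x^-1]. So the meet is the product of the meet of
    [x] and [1] with the positive part of [x^-1], and these factors are mutually inverse. *)
Lemma pos_part_disjoint x : (x `|` 1) `&` (x^-1 `|` 1) = 1.
Proof.
have -> : x `|` 1 = x * (x^-1 `|` 1) by rewrite mulg_joinr mulgV mulg1 joinC.
rewrite -[X in _ `&` X]mul1g -mulg_meetl.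
by rewrite -{2}invg1 -invg_meet mulgV.
Qed.

Definition archimedean_lgroup :=
  forall x y, (forall n, x ^+ n <= y) -> x <= 1.

(** If [s] is the supremum of the powers of [x], then [x^-1 * s] is an upper bound too, so
    [s <= x^-1 * s]. *)
Lemma dedekind_sigma_complete_archimedean :
  dedekind_sigma_complete G -> archimedean_lgroup.
Proof.
move=> sc x y xy.
have [|||s [ub lub]] := sc (range (fun n => x ^+ n)).
- exact: card_le_trans (card_image_le _ _) (countableP _).
- by exists (x ^+ 0); exists 0%N.
- by exists y => _ [n _ <-].
rewrite -[x]mulg1 lgroup_leVr invg1 mulg1.
rewrite -(mulgK s x) lgroup_divle1 lgroup_leVl; apply: lub => _ [n _ <-].
by rewrite -lgroup_leVl -expgS; apply: ub; exists n.+1.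
Qed.


(* [p] forces [h <= 1]. *)
Definition forces p h := (h `|` 1) `&` p = 1.

Lemma forcesS p q h : 1 <= q -> q <= p -> forces p h -> forces q h.
Proof.
move=> q1 qp; rewrite /forces !(meetC (h `|` 1)).
by apply: disjointS; rewrite ?leUr.
Qed.

Lemma forcesW p h k : 1 <= p -> h <= k -> forces p k -> forces p h.
Proof.
by move=> p1 hk; apply: disjointS; rewrite ?leUr ?leU2.
Qed.

Lemma forces_le1 p h : 1 <= p -> h <= 1 -> forces p h.
Proof. by move=> p1 h1; rewrite /forces (join_r h1); exact/meet_l. Qed.

Lemma forcesM p h k : 1 <= p -> forces p h -> forces p k -> forces p (h * k).
Proof.
move=> p1 ph pk.
apply: (@disjointS p _ ((h `|` 1) * (k `|` 1))); rewrite ?leUr//.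
  by rewrite leUx lgroup_leM ?leUl// lgroup_leMx ?leUr.
by apply: disjointM; rewrite ?leUr.
Qed.

(** The witness is the meet of [p] with the positive part of [h], which is disjoint from the
    positive part of [h^-1]. *)
Lemma forcesN p h : 1 <= p -> ~ forces p h ->
  exists q, [/\ 1 < q, q <= p & forces q h^-1].
Proof.
move=> p1 /eqP nph; have q1 : 1 <= (h `|` 1) `&` p by rewrite lexI leUr.
exists ((h `|` 1) `&` p); split; [by rewrite lt_def nph|exact: leIr|].
rewrite /forces meetC; apply: (disjointS _ q1 (leIl _ _)); rewrite ?leUr//.
exact: pos_part_disjoint.
Qed.

(** The positive part of [p ^+ n * y^-1] is disjoint from [p], hence from [p ^+ n]; being below
    [p ^+ n], it is [1]. This turns a failure of density into an inequality that the archimedean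
    property or a supremum refutes. *)
Lemma forces_expg_le p y t n : 1 <= p -> 1 <= y -> forces p t ->
  p ^+ n * y^-1 <= t -> p ^+ n <= y.
Proof.
move=> p1 y1 pt pyt; rewrite -lgroup_divle1.
have := forcesW p1 pyt pt; rewrite /forces meetC => /disjointX.
move=> /(_ n (leUr _ _) p1); rewrite meet_r => [<-|]; first exact: leUl.
rewrite leUx lgroup_le1X// andbT -[leRHS]mulg1 lgroup_le2l//.
by rewrite lgroup_leV1.
Qed.

Definition dense_below (D : set G) :=
  forall p, 1 < p -> exists q, [/\ 1 < q, q <= p & D q].

Lemma dense_decide h : dense_below [set q | forces q h \/ forces q h^-1].
Proof.
move=> p p1; have [ph|nph] := pselect (forces p h).
  by exists p; split=> //; left.
by have [q [q1 qp qh]] := forcesN (ltW p1) nph; exists q; split=> //; right.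
Qed.

(** * Normality of polars and approximation of suprema *)

Section Archimedean.
Context (arch : archimedean_lgroup).

(* If [c] is disjoint from [c ^ x] with [1 <= x], then [c ^+ n <= x] for all
   [n]: the element [x^-1 * (c ^+ n `|` x)] is below both [c ^+ n] and its
   conjugate by [x]. *)
Lemma disjoint_conj_self c x : 1 <= c -> 1 <= x -> c `&` c ^ x = 1 -> c = 1.
Proof.
move=> c1 x1 cx; apply: le_anti; rewrite c1 andbT; apply: (arch (y := x)) => n.
have cn1 := lgroup_le1X n c1.
have cnx : c ^+ n `&` (c ^ x) ^+ n = 1.
  apply: disjointX => //; first exact/lgroup_le1X/conjg_ge1.
  rewrite meetC; apply: disjointX => //; [exact: conjg_ge1|by rewrite meetC].
rewrite -conjXg in cnx.
have : x^-1 * (c ^+ n `|` x) <= c ^+ n `&` c ^+ n ^ x.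
  rewrite lexI conjgE; apply/andP; split.
    rewrite mulg_joinr mulVg leUx cn1 andbT -[leRHS]mul1g lgroup_le2r//.
    by rewrite lgroup_leV1.
  apply: lgroup_le2l; rewrite leUx -{1}[c ^+ n]mulg1 lgroup_le2l//=.
  by rewrite -{1}[x]mul1g lgroup_le2r.
rewrite cnx lgroup_leVl invgK mulg1; exact: le_trans (leUl _ _).
Qed.

(** For positive [x], let [c] be the meet of [a ^ x] and [b]. Then [c ^ x^-1] is below [a] and [c]
    is below [b], so [c] is disjoint from [c ^ x] and [disjoint_conj_self] applies; [x^-1] is
    treated alike. A general [x] is a quotient of two positive elements. *)
Lemma disjoint_conj a b x : 1 <= a -> 1 <= b -> a `&` b = 1 ->
  a ^ x `&` b = 1.
Proof.
have pos y a' : 1 <= y -> 1 <= a' -> 1 <= b -> a' `&` b = 1 ->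
    a' ^ y `&` b = 1 /\ a' ^ y^-1 `&` b = 1.
  move=> y1 a1 b1 ab; have meet1 c1 c2 : 1 <= c1 -> 1 <= c2 ->
      c1 <= a' -> c2 <= b -> c1 `&` c2 = 1.
    move=> c11 c21 ca cb; apply: le_anti.
    by rewrite lexI c11 c21 -ab leI2.
  split.
    have c1 : 1 <= a' ^ y `&` b by rewrite lexI conjg_ge1.
    apply: (disjoint_conj_self c1 y1).
    set c := _ `&` b in c1 *; rewrite -{1}(conjgKV y c) -conjg_meet.
    rewrite meet1 ?conj1g ?conjg_ge1 ?leIr//.
    by rewrite conjg_meet conjgK leIl.
  have c1 : 1 <= a' ^ y^-1 `&` b by rewrite lexI conjg_ge1.
  apply: (disjoint_conj_self c1 y1); rewrite meetC.
  by rewrite meet1 ?conjg_ge1 ?leIr// conjg_meet conjgKV leIl.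
move=> a1 b1 ab.
have -> : x = (x `|` 1) * (x^-1 `|` 1)^-1.
  rewrite -[X in X * _](mulVKg x) mulg_joinr mulVg mulg1 joinC.
  by rewrite mulgK.
rewrite conjgM.
have [xab _] := pos _ _ (leUr 1 x) a1 b1 ab.
by have [] := pos _ _ (leUr 1 x^-1) (conjg_ge1 _ a1) b1 xab.
Qed.

Lemma forcesJ p h x : 1 <= p -> forces p h -> forces p (h ^ x).
Proof.
move=> p1 ph; rewrite /forces -[X in _ `|` X](conj1g x) -conjg_join.
by apply: disjoint_conj => //; exact: leUr.
Qed.

(** A substitute for commutativity. The positive parts of [x^-1 * y], a conjugate of [y * x^-1], and
    of [x * y^-1] are disjoint; multiply by [x] on the left and by [y] on the right. *)
Lemma meet_sqr_le x y : (x * x) `&` (y * y) <= x * y.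
Proof.
have /= := disjoint_conj y (leUr 1 _) (leUr 1 _) (pos_part_disjoint (y * x^-1)).
rewrite invgM invgK conjg_join conj1g conjgE -mulgA mulKg => dis.
have : (x^-1 * y) `&` (x * y^-1) <= 1 by rewrite -dis leI2 ?leUl.
move=> /(lgroup_le2l x)/(lgroup_le2r y).
by rewrite mulg_meetr mulg_meetl mulg1 mulVKg mulgA mulgVK meetC.
Qed.

Lemma isLub_divg_le1 (A : set G) s c : isLub A s ->
  (forall a, A a -> c <= s * a^-1) -> c <= 1.
Proof.
move=> [_ lub] cA; rewrite -(mulgV s) -lgroup_leVr lgroup_leVl.
by apply: lub => a Aa; rewrite -lgroup_leVl lgroup_leVr; exact: cA.
Qed.

(** By [meet_sqr_le], [c] is below the product of the [2 ^ j]-th powers of [s * a^-1] and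
    [s * b^-1]. The induction hypothesis removes one factor, then the other; hence exponents that
    are powers of two. *)
Lemma isLub_divg_exp2_le1 (A : set G) s j c : isLub A s ->
  (forall a, A a -> c <= (s * a^-1) ^+ (2 ^ j)) -> c <= 1.
Proof.
move=> lub; elim: j c => [|j IH] c cA; first exact: isLub_divg_le1 cA.
apply: (IH) => b Ab; rewrite -lgroup_divle1; apply: (IH) => a Aa.
rewrite lgroup_leVr invgK; apply: le_trans (meet_sqr_le _ _).
by rewrite lexI -!expgnDr addnn -mul2n -expnS !cA.
Qed.

(** * Dense sets provided by the weak unit *)

Section WeakUnit.
Context (u : G) (wu : weak_unit u).

Lemma weak_unit_ge1 : 1 <= u. Proof. by case: wu. Qed.

Lemma meet_weak_unit_gt1 p : 1 < p -> 1 < p `&` u.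
Proof.
move=> p1; have [u1 uI] := wu; rewrite lt_def lexI u1 ltW// !andbT.
by apply/eqP => /uI pE; rewrite pE ltxx in p1.
Qed.

(** Otherwise the meet of [p] and [u] forces [u ^+ n <= f] for every [n], so all its powers are
    below the positive part of [f], against the archimedean property. *)
Lemma dense_bounded f :
  dense_below [set q | exists n, forces q (f * (u ^+ n)^-1)].
Proof.
move=> p /meet_weak_unit_gt1 p1; have p1' := ltW p1.
have [[n nu]|nf] := pselect (exists n, ~ forces (p `&` u) (u ^+ n * f^-1)).
  have [q [q1 qp qu]] := forcesN p1' nu; exists q; split=> //.
    exact: le_trans qp (leIl _ _).
  by exists n; rewrite invgM invgK in qu.
case/lt_geF/negbT/negP: p1; apply: (arch (y := f `|` 1)) => n.
apply: (forces_expg_le (t := u ^+ n * f^-1)) => //; first exact: leUr.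
  by apply: contrapT => fn; apply: nf; exists n.
by apply: lgroup_leM; [exact/lgroup_leX/leIr|rewrite lgroup_leV leUl].
Qed.

(** Otherwise the meet of [p] and [u] is below [(s * a^-1) ^+ (2 ^ j)] for every [a] in [A], hence
    below [1]. *)
Lemma dense_isLub (A : set G) s j : isLub A s -> dense_below
  [set q | exists2 a, A a & forces q ((s * a^-1) ^+ (2 ^ j) * u^-1)].
Proof.
move=> lub p /meet_weak_unit_gt1 p1; have p1' := ltW p1.
have [[a Aa nu]|nf] := pselect (exists2 a, A a &
    ~ forces (p `&` u) (u * ((s * a^-1) ^+ (2 ^ j))^-1)).
  have [q [q1 qp qu]] := forcesN p1' nu; exists q; split=> //.
    exact: le_trans qp (leIl _ _).
  by exists a => //; rewrite invgM invgK in qu.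
case/lt_geF/negbT/negP: p1; apply: (isLub_divg_exp2_le1 (j := j) lub) => a Aa.
rewrite -[X in X <= _]expg1.
apply: (forces_expg_le (t := u * ((s * a^-1) ^+ (2 ^ j))^-1)) => //.
- by apply: lgroup_le1X; rewrite lgroup_div1le; apply: lub.1.
- by apply: contrapT => fn; apply: nf; exists a.
- by rewrite expg1 lgroup_le2r// leIr.
Qed.

(** This provides the initial condition: a function compatible with it satisfies [1 <= n * x c], so
    it does not vanish at [c]. *)
Lemma forces_weak_unit_le c : 1 < c ->
  exists p n, 1 < p /\ forces p (u * (c ^+ n)^-1).
Proof.
move=> /meet_weak_unit_gt1 p1; have p1' := ltW p1.
have [[n nu]|nf] := pselect (exists n, ~ forces (c `&` u) (c ^+ n * u^-1)).
  have [q [q1 qp qu]] := forcesN p1' nu; exists q, n; split=> //.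
  by rewrite invgM invgK in qu.
case/lt_geF/negbT/negP: p1; apply: (arch (y := u)) => n.
apply: (forces_expg_le (t := c ^+ n * u^-1)) => //; first exact: weak_unit_ge1.
  by apply: contrapT => fn; apply: nf; exists n.
by apply: lgroup_le2r; exact/lgroup_leX/leIl.
Qed.

End WeakUnit.
End Archimedean.
End LGroupTheory.

(** * Hoelder's theorem for totally preordered groups *)

Section IntegerPower.
Context (G : groupType).
Implicit Types (x : G) (m n : int).
Local Open Scope group_scope.

Definition expgz x (m : int) : G :=
  match m with Posz n => x ^+ n | Negz n => x ^- n.+1 end.

Lemma expgz_subn x (a b : nat) : expgz x (a%:Z - b%:Z)%R = x ^+ a * x ^- b.
Proof.
have [ba|/ltnW ab] := leqP b a; first by rewrite subzn//= expgnFr.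
rewrite -opprB subzn//.
have -> : x ^+ a * x ^- b = x ^- (b - a).
  by rewrite expgnFr// invgM invgK.
by case: (b - a)%N => [|n]; rewrite ?oppr0 ?expg0 ?invg1.
Qed.

Lemma int_subn_ex m : exists a b : nat, m = (a%:Z - b%:Z)%R.
Proof.
case: m => n; first by exists n, 0%N; rewrite subr0.
by exists 0%N, n.+1; rewrite sub0r NegzE.
Qed.

Lemma expgzD x m n : expgz x (m + n)%R = expgz x m * expgz x n.
Proof.
have [a [b ->]] := int_subn_ex m; have [a' [b' ->]] := int_subn_ex n.
rewrite [X in expgz x X](_ : _ = (a + a')%:Z - (b + b')%:Z)%R; last first.
  by rewrite !PoszD; ring.
rewrite !expgz_subn (addnC b) !expgnDr invgM !mulgA; congr (_ * _).
rewrite -!mulgA; congr (_ * _).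
by apply: commuteV; apply: commuteX2; exact: commute_refl.
Qed.

Lemma expgzN x m : expgz x (- m)%R = (expgz x m)^-1.
Proof.
by rewrite -[LHS]mulg1 -(mulgV (expgz x m)) mulgA -expgzD addNr mul1g.
Qed.

Lemma expgzMn x m (k : nat) : expgz x (m * k%:Z)%R = expgz x m ^+ k.
Proof.
elim: k => [|k IH]; first by rewrite mulr0.
by rewrite -addn1 PoszD mulrDr mulr1 expgzD IH addn1 expgSr.
Qed.

End IntegerPower.

(** * The additive monotone function of a preorder with strong unit *)

Section Holder.
Context (R : realType) (G : groupType) (H : set G) (u : G).
Context (le : G -> G -> Prop).
Context (Hu : H u).
Context (HM : forall x y, H x -> H y -> H (x * y)%g).
Context (HV : forall x, H x -> H x^-1%g).
Context (le_refl : forall x, le x x).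
Context (le_trans : forall y x z, le x y -> le y z -> le x z).
Context (leM : forall x y z t, le x y -> le z t -> le (x * z)%g (y * t)%g).
Context (le_total : forall x y, H x -> H y -> le x y \/ le y x).
Context (le_bounded : forall x, H x -> exists n, le x (u ^+ n)%g).
Context (unit_ge1 : le 1%g u).
Context (unit_gt1 : ~ le u 1%g).
Implicit Types (f g x y : G) (m : int) (k n : nat).

Local Lemma group1_mem : H 1%g.
Proof. by rewrite -(mulgV u); apply: HM => //; exact: HV. Qed.

Local Lemma expg_mem x n : H x -> H (x ^+ n)%g.
Proof.
move=> Hx; elim: n => [|n IH]; first by rewrite expg0; exact: group1_mem.
by rewrite expgS; exact: HM.
Qed.

Local Lemma expgz_mem x m : H x -> H (expgz x m).
Proof. by move=> Hx; case: m => n /=; [|apply: HV]; exact: expg_mem. Qed.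

Local Lemma leX x y n : le x y -> le (x ^+ n)%g (y ^+ n)%g.
Proof.
by move=> xy; elim: n => [|n IH]; rewrite ?expg0// !expgS; exact: leM.
Qed.

Local Lemma leV x y : le x y -> le y^-1%g x^-1%g.
Proof.
move=> xy; have := leM (leM (le_refl x^-1%g) xy) (le_refl y^-1%g).
by rewrite mulVg mul1g mulgK.
Qed.

Local Lemma le_expgM f g n :
  le (f * g)%g (g * f)%g -> le (f ^+ n * g ^+ n)%g ((f * g) ^+ n)%g.
Proof.
move=> fg; have comm k : le (f ^+ k * g)%g (g * f ^+ k)%g.
  elim: k => [|k IH]; first by rewrite !expg0 mulg1 mul1g.
  rewrite expgS -mulgA; apply: le_trans (leM (le_refl f) IH) _.
  by rewrite !mulgA; exact: leM.
elim: n => [|n IH]; first by rewrite !expg0 mulg1.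
rewrite [((f * g) ^+ _)%g]expgS; apply: le_trans (leM (le_refl _) IH).
rewrite !expgS -!mulgA; apply: leM => //; rewrite !mulgA.
exact: leM.
Qed.

Local Lemma le_expgz (m n : int) : le (expgz u m) (expgz u n) -> (m <= n)%R.
Proof.
move=> mn; rewrite leNgt; apply/negP => nm; apply: unit_gt1.
have := leM mn (le_refl (expgz u (- n)%R)); rewrite -!expgzD subrr.
have : (0 < m - n)%R by rewrite subr_gt0.
case: (m - n)%R => [[//|k] _|//] /=; apply: le_trans.
rewrite -[X in le X](mulg1 u) expgS; apply: leM => //.
by rewrite -(expg1n _ k); exact: leX.
Qed.

Local Open Scope classical_set_scope.
Local Open Scope ring_scope.

Definition holder_cut f : set R :=
  [set r | exists m k, [/\ (0 < k)%N, le (expgz u m) (f ^+ k)%g &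
                            r = m%:~R / k%:R]].

Definition holder_val f : R := sup (holder_cut f).

Lemma holder_cut_has_ubound f : H f -> has_ubound (holder_cut f).
Proof.
move=> /le_bounded[n fn]; exists n%:R => _ [m [k [k0 mk ->]]].
rewrite ler_pdivrMr ?ltr0n// -natrM -[(n * k)%:R]/((n * k)%:Z%:~R) ler_int.
by apply/le_expgz/(le_trans mk); rewrite /= expgnA; exact: leX.
Qed.

Lemma holder_cut_nonempty f : H f -> holder_cut f !=set0.
Proof.
move=> /HV/le_bounded[n fn]; exists ((- n%:Z)%:~R / 1%:R).
exists (- n%:Z), 1%N; split=> //.
by rewrite expgzN/= expg1 -(invgK f); exact: leV.
Qed.

Lemma holder_val_ge f m k : H f -> (0 < k)%N ->
  le (expgz u m) (f ^+ k)%g -> m%:~R / k%:R <= holder_val f.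
Proof.
move=> Hf k0 mk; apply: (ub_le_sup (holder_cut_has_ubound Hf)).
by exists m, k.
Qed.

Lemma holder_val_le f (r : R) : H f ->
  (forall m k, (0 < k)%N -> le (expgz u m) (f ^+ k)%g -> m%:~R / k%:R <= r) ->
  holder_val f <= r.
Proof.
move=> Hf fr; apply: ge_sup; first exact: holder_cut_nonempty.
by move=> _ [m [k [k0 mk ->]]]; exact: fr.
Qed.

Lemma holder_val_mono f g : H f -> H g -> le f g ->
  holder_val f <= holder_val g.
Proof.
move=> Hf Hg fg; apply: holder_val_le => // m k k0 mk.
by apply: holder_val_ge => //; apply: le_trans mk _; exact: leX.
Qed.

Lemma holder_val_unit : holder_val u = 1.
Proof.
apply/eqP; rewrite eq_le; apply/andP; split.
  apply: holder_val_le => // m k k0 /(@le_expgz m k) mk.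
  by rewrite ler_pdivrMr ?ltr0n// mul1r -[k%:R]/(k%:Z%:~R) ler_int.
by rewrite -[leLHS]divr1; apply: (@holder_val_ge u 1 1).
Qed.

Lemma holder_val1_le : holder_val 1%g <= 0.
Proof.
apply: holder_val_le => [|m k k0]; first exact: group1_mem.
rewrite expg1n => /(@le_expgz m 0) m0.
by rewrite ler_pdivrMr ?ltr0n// mul0r lerz0.
Qed.

(* Commutativity is not needed: if [f * g] is below [g * f], then
   [f ^+ n * g ^+ n] is below [(f * g) ^+ n], and symmetrically. *)
Lemma holder_val_superM f g : H f -> H g ->
  holder_val f + holder_val g <= holder_val (f * g)%g.
Proof.
move=> Hf Hg; rewrite -lerBrDr; apply: holder_val_le => // m k k0 mk.
rewrite lerBrDr addrC -lerBrDr; apply: holder_val_le => // n l l0 nl.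
rewrite lerBrDr.
have -> : n%:~R / l%:R + m%:~R / k%:R =
    (m * l%:Z + n * k%:Z)%:~R / (k * l)%:R :> R.
  rewrite natrM intrD !intrM; field.
  by rewrite !pnatr_eq0 -!lt0n k0 l0.
apply: holder_val_ge; [exact: HM|by rewrite muln_gt0 k0|].
have mkl : le (expgz u m ^+ l)%g (f ^+ (k * l))%g.
  by rewrite expgnA; exact: leX.
have nkl : le (expgz u n ^+ k)%g (g ^+ (k * l))%g.
  by rewrite mulnC expgnA; exact: leX.
have [fg|gf] := le_total (HM Hf Hg) (HM Hg Hf).
  rewrite expgzD !expgzMn; apply: le_trans (le_expgM _ fg); exact: leM.
rewrite addrC expgzD !expgzMn; apply: le_trans (leX _ gf).
by apply: le_trans (le_expgM _ gf); exact: leM.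
Qed.

(** Otherwise a rational [q] lies strictly between [holder_val f] and [- holder_val f^-1]. Comparing
    [u ^ numq q] with [f ^ denq q] contradicts one of the two inequalities. *)
Lemma holder_valV_ge f : H f -> 0 <= holder_val f + holder_val f^-1%g.
Proof.
move=> Hf; rewrite leNgt; apply/negP; rewrite -ltrBrDr sub0r.
move=> /rat_in_itvoo[q]; rewrite in_itv/= => /andP[fq qf].
have k0 : (0 < `|denq q|)%N by rewrite absz_gt0.
have qE : ratr q = (numq q)%:~R / `|denq q|%N%:R :> R.
  by rewrite /ratr natr_absz gtr0_norm.
have [|/leV] := le_total (expgz_mem (numq q) Hu) (expg_mem `|denq q| Hf).
- move=> /(holder_val_ge Hf k0); rewrite -qE leNgt fq//.
- rewrite -expgzN -expVgn => /(holder_val_ge (HV Hf) k0).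
  by rewrite intrN mulNr -qE lerNl leNgt qf.
Qed.

(** Superadditivity at [f * g] and [g^-1] bounds the left side by [holder_val f - holder_val g^-1];
    [holder_valV_ge] finishes. *)
Lemma holder_valM f g : H f -> H g ->
  holder_val (f * g)%g = holder_val f + holder_val g.
Proof.
move=> Hf Hg; apply/eqP; rewrite eq_le holder_val_superM// andbT.
have := holder_val_superM (HM Hf Hg) (HV Hg); rewrite mulgK.
have := holder_val_superM Hg (HV Hg); rewrite mulgV.
have := holder_valV_ge Hg; have := holder_val1_le.
lra.
Qed.

Lemma holder_embedding : exists x : G -> R,
  [/\ x u = 1, forall f g, H f -> H g -> x (f * g)%g = x f + x g &
      forall f g, H f -> H g -> le f g -> x f <= x g].
Proof.
exists holder_val; split.
- exact: holder_val_unit.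
- exact: holder_valM.
- exact: holder_val_mono.
Qed.

End Holder.

(** * Generic real-valued functions *)

Section GenericReal.
Context (d : Order.disp_t) (G : lgroupType d).
Implicit Types f g h p q s x : G.
Local Open Scope classical_set_scope.
Local Open Scope order_scope.
Local Open Scope group_scope.

(** Generic trees serve as terms in the l-group operations because they are countable over a
    countable type. Malformed nodes get the value [1]. *)
Fixpoint lgroup_eval (I : Type) (e : I -> G) (t : GenTree.tree I) : G :=
  match t with
  | GenTree.Leaf i => e i
  | GenTree.Node 0 [:: t1; t2] => lgroup_eval e t1 * lgroup_eval e t2
  | GenTree.Node 1 [:: t1; t2] => lgroup_eval e t1 `&` lgroup_eval e t2
  | GenTree.Node 2 [:: t1; t2] => lgroup_eval e t1 `|` lgroup_eval e t2
  | GenTree.Node 3 [:: t1] => (lgroup_eval e t1)^-1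
  | GenTree.Node _ _ => 1
  end.

Lemma sublgroup_countable (I : countType) (e : I -> G) : exists h : nat -> G,
  [/\ forall i, range h (e i),
      forall x, range h x -> range h x^-1 &
      forall x y, range h x -> range h y ->
        [/\ range h (x * y), range h (x `&` y) & range h (x `|` y)]].
Proof.
pose h n := if unpickle n is Some t then lgroup_eval e t else 1.
have hE x : range h x <-> exists t, lgroup_eval e t = x.
  split=> [[n _ <-]|[t <-]].
    rewrite /h; case: unpickle => [t|]; first by exists t.
    (* A malformed node gives [1], the value of [h] at numbers that code no term. *)
    by exists (GenTree.Node 4 [::]).
  by exists (pickle t) => //; rewrite /h pickleK.
exists h; split.
- by move=> i; apply/hE; exists (GenTree.Leaf i).
- by move=> x /hE[t <-]; apply/hE; exists (GenTree.Node 3 [:: t]).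
- move=> x y /hE[t <-] /hE[t' <-]; split; apply/hE.
  + by exists (GenTree.Node 0 [:: t; t']).
  + by exists (GenTree.Node 1 [:: t; t']).
  + by exists (GenTree.Node 2 [:: t; t']).
Qed.

Lemma rasiowa_sikorski (I : countType) (D : I -> set G) p0 : 1 < p0 ->
  (forall i, dense_below (D i)) -> exists p : nat -> G,
  [/\ p 0 = p0, forall n, 1 < p n, forall n, p n.+1 <= p n &
      forall i, exists n, D i (p n)].
Proof.
move=> p01 dD.
(* One step of the construction: enter the dense set coded by [np.1], or keep the condition if there
   is none. The value [1] is a default outside the conditions. *)
have /choice[next nextP] (np : nat * G) : exists q, 1 < np.2 ->
    [/\ 1 < q, q <= np.2 & forall i, unpickle np.1 = Some i -> D i q].
  case: np => n p; have [p1|] := pselect (1 < p); last by exists 1.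
  case: (unpickle n) => [i|]; last by exists p.
  by have [q [q1 qp Dq]] := dD i p p1; exists q => _; split=> // _ [<-].
pose p := fix p n := if n is m.+1 then next (m, p m) else p0.
have p1 n : 1 < p n by elim: n => //= n /(nextP (n, p n))[].
exists p; split=> // [n|i]; first by have [] := nextP (n, p n) (p1 n).
exists (pickle i).+1; have [_ _] := nextP (pickle i, p (pickle i)) (p1 _).
by apply; rewrite pickleK.
Qed.

(** * The preorder induced by a decreasing sequence of conditions *)

Section FilterPreorder.
Context (arch : archimedean_lgroup G) (p : nat -> G).
Context (p_gt1 : forall n, 1 < p n) (p_dec : forall n, p n.+1 <= p n).

Definition filter_le f g := exists n, forces (p n) (f * g^-1).

Local Lemma p_nonincr m n : (m <= n)%N -> p n <= p m.
Proof.
move=> /subnK <-; elim: (n - m)%N => [//|k]; exact/le_trans/p_dec.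
Qed.

Local Lemma forces_nonincr m n h :
  (m <= n)%N -> forces (p m) h -> forces (p n) h.
Proof. by move=> mn; apply: forcesS; [exact: ltW|exact: p_nonincr]. Qed.

Lemma le_filter_le f g : f <= g -> filter_le f g.
Proof.
by move=> fg; exists 0; apply: forces_le1; rewrite ?lgroup_divle1// ltW.
Qed.

Lemma filter_le_trans g f h : filter_le f g -> filter_le g h -> filter_le f h.
Proof.
move=> [m fg] [n gh]; exists (maxn m n); rewrite -(divgKA g f h^-1).
apply: forcesM; first exact: ltW.
  exact: forces_nonincr (leq_maxl _ _) fg.
exact: forces_nonincr (leq_maxr _ _) gh.
Qed.

Lemma filter_leM f g h k :
  filter_le f g -> filter_le h k -> filter_le (f * h) (g * k).
Proof.
move=> [m fg] [n hk]; exists (maxn m n).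
(* The quotient of the products involves a conjugate, which [forcesJ] absorbs. *)
have -> : f * h * (g * k)^-1 = (h * k^-1) ^ f^-1 * (f * g^-1).
  by rewrite conjgE invgK invgM !mulgA mulgVK.
apply: forcesM; first exact: ltW.
  apply: forcesJ => //; first exact: ltW.
  exact: forces_nonincr (leq_maxr _ _) hk.
exact: forces_nonincr (leq_maxl _ _) fg.
Qed.

Lemma filter_le_meet f g : filter_le f g -> filter_le f (f `&` g).
Proof.
move=> [n fg]; exists n; rewrite invg_meet mulg_joinr mulgV.
by rewrite /forces joinC joinA joinxx joinC.
Qed.

Lemma filter_le_join f g : filter_le f g -> filter_le (f `|` g) g.
Proof.
by move=> [n fg]; exists n; rewrite mulg_joinl mulgV /forces -joinA joinxx.
Qed.

Lemma filter_le_unit1 u : weak_unit u -> ~ filter_le u 1.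
Proof.
move=> wu [n]; rewrite invg1 mulg1 /forces join_l ?(weak_unit_ge1 wu)// meetC.
move=> pE; have := meet_weak_unit_gt1 wu (p_gt1 n).
by rewrite pE ltxx.
Qed.

End FilterPreorder.

(* The rows of [T] play two roles: their entries are the elements on which [x]
   has to preserve the operations, their ranges the sets whose suprema it has
   to preserve. *)
Definition respects (R : realType) (u : G) (T : nat -> nat -> G) (x : G -> R) :=
  [/\ x u = 1%R,
      forall i j k l, let f := T i j in let g := T k l in
        [/\ x (f * g) = (x f + x g)%R, x (f `&` g) = Num.min (x f) (x g) &
            x (f `|` g) = Num.max (x f) (x g)] &
      forall i s, isLub (range (T i)) s -> isLub (range (x \o T i)) (x s)].

Lemma respects_generic (R : realType) (u : G) (T : nat -> nat -> G) c :
  archimedean_lgroup G -> weak_unit u -> 1 < c ->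
  exists2 x : G -> R, respects u T x & x c <> 0%R.
Proof.
move=> arch wu c1.
(* [s i] is the supremum of row [i] if there is one, and [1] by default. *)
have /choice[s sP] i : exists s,
    (exists s', isLub (range (T i)) s') -> isLub (range (T i)) s.
  by have [[s ls]|] := pselect (exists s', isLub (range (T i)) s');
    [exists s|exists 1].
pose e (i : nat * nat + nat + bool) := match i with
  | inl (inl (i, j)) => T i j
  | inl (inr i) => s i
  | inr b => if b then u else c end.
have [h [eh hV hops]] := sublgroup_countable e; pose H := range h.
have hM x y : H x -> H y -> H (x * y) by move=> Hx /(hops x y Hx)[].
have HT i j : H (T i j) by exact: (eh (inl (inl (i, j)))).
have Hs i : H (s i) by exact: (eh (inl (inr i))).
have Hu : H u by exact: (eh (inr true)).
have Hc : H c by exact: (eh (inr false)).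
(* These families make the preorder total on [H], make [u] a strong unit there, and approximate
   suprema; the last is vacuous for rows without supremum. *)
pose D (i : nat + nat + nat * nat) : set G := match i with
  | inl (inl i) => [set q | forces q (h i) \/ forces q (h i)^-1]
  | inl (inr i) => [set q | exists n, forces q (h i * (u ^+ n)^-1)]
  | inr (i, j) => [set q | isLub (range (T i)) (s i) -> exists2 a,
      range (T i) a & forces q ((s i * a^-1) ^+ (2 ^ j) * u^-1)]
  end.
have [p0 [n0 [p01 p0c]]] := forces_weak_unit_le arch wu c1.
have dD i : dense_below (D i).
  case: i => [[i|i]|[i j]] /=; [exact: dense_decide|exact: dense_bounded|].
  have [ls|nls] := pselect (isLub (range (T i)) (s i)).
    move=> p /(dense_isLub arch wu j ls)[q [q1 qp Dq]].
    by exists q; split=> // _; exact: Dq.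
  by move=> p p1; exists p; split=> // ls.
have [p [p0E p1 pdec pD]] := rasiowa_sikorski p01 dD.
pose le := filter_le p.
have lexx f : le f f by exact: le_filter_le.
have letr := filter_le_trans p1 pdec.
have leM := filter_leM arch p1 pdec.
have letot f g : H f -> H g -> le f g \/ le g f.
  move=> Hf Hg; have [i _ hi] := hM _ _ Hf (hV _ Hg).
  have [n] := pD (inl (inl i)); rewrite /= hi invgM invgK.
  by case=> fg; [left|right]; exists n.
have lebd f : H f -> exists n, le f (u ^+ n).
  move=> [i _ <-]; have [n [k hk]] := pD (inl (inr i)).
  by exists k, n.
have le1u : le 1 u by apply: le_filter_le => //; exact: weak_unit_ge1 wu.
have nleu1 : ~ le u 1 by exact: filter_le_unit1.
have [x [xu xM xle]] :=
  @holder_embedding R G H u le Hu hM hV lexx letr leM letot lebd le1u nleu1.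
have HX f n : H f -> H (f ^+ n).
  move=> Hf; elim: n => [|n IH]; last by rewrite expgS; exact: hM.
  by rewrite expg0 -(mulgV f); apply: hM => //; exact: hV.
have xX f n : H f -> x (f ^+ n) = (x f *+ n)%R.
  move=> Hf; elim: n => [|n IH]; last first.
    by rewrite expgS xM ?IH ?mulrS//; exact: HX.
  have := xM _ _ (HX f 0%N Hf) (HX f 0%N Hf); rewrite expg0 mulg1 mulr0n.
  by move=> /eqP; rewrite -subr_eq subrr => /eqP.
exists x; last first.
  have : le u (c ^+ n0) by exists 0%N; rewrite p0E.
  move=> /xle; rewrite xu xX// => /(_ Hu (HX _ _ Hc)) + xc0.
  by rewrite xc0 mul0rn ler10.
split=> //.
- move=> i j k l f g; have Hf := HT i j : H f; have Hg := HT k l : H g.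
  have [Hfg HI HU] := hops _ _ Hf Hg.
  split; first exact: xM.
    have [fg|gf] := letot _ _ Hf Hg.
      rewrite min_l ?xle//; apply/eqP; rewrite eq_le !xle//.
        exact: filter_le_meet.
      by apply: le_filter_le => //; exact: leIl.
    rewrite min_r ?xle//; apply/eqP; rewrite eq_le !xle//.
      by rewrite meetC; exact: filter_le_meet.
    by apply: le_filter_le => //; exact: leIr.
  have [fg|gf] := letot _ _ Hf Hg.
    rewrite max_r ?xle//; apply/eqP; rewrite eq_le !xle//.
      by apply: le_filter_le => //; exact: leUr.
    exact: filter_le_join.
  rewrite max_l ?xle//; apply/eqP; rewrite eq_le !xle//.
    by apply: le_filter_le => //; exact: leUl.
  by rewrite joinC; exact: filter_le_join.
- move=> i s' ls'; have ls : isLub (range (T i)) (s i) by apply: sP; exists s'.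
  have -> : s' = s i.
    by apply: le_anti; rewrite ls'.2 ?ls.2 //; [exact: ls'.1|exact: ls.1].
  split.
    move=> _ [j _ <-] /=; apply: xle => //; apply: le_filter_le => //.
    by apply: ls.1; exists j.
  move=> y yub; rewrite leNgt; apply/negP => ys.
  (* With this [k], [2 ^ k] exceeds the inverse of [x (s i) - y]. Some entry of the row is so close
     to [s i] that its [x]-distance to it is at most [1 / 2 ^ k], hence too small for [y] to be an
     upper bound. *)
  pose k := (Num.truncn (x (s i) - y)^-1%R).+1.
  have [n /(_ ls)[_ [l _ <-] fk]] := pD (inr (i, k)).
  set b := s i * _ in fk.
  have Hb : H b by apply: hM => //; exact/hV/HT.
  have sE : x (s i) = (x b + x (T i l))%R by rewrite -xM// /b mulgVK.
  have {}fk : (x b *+ (2 ^ k) <= 1)%R.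
    by rewrite -xu -xX//; apply: xle => //; [exact: HX|exists n].
  have yT : (x (T i l) <= y)%R by apply: yub; exists l.
  have e0 : (0 < x (s i) - y)%R by rewrite subr_gt0.
  have : ((x (s i) - y)^-1 < (2 ^ k)%:R)%R.
    apply: lt_trans (truncnS_gt _) _; rewrite ltr_nat; exact: ltn_expl.
  rewrite -(ltr_pM2l e0) divff ?gt_eqF// mulr_natr ltNge => /negP; apply.
  apply: le_trans fk; rewrite lerMn2r; apply/orP; right.
  by rewrite sE; lra.
Qed.

End GenericReal.

(** * The representation *)

Section NullIdeal.
Context (R : realType) (d : Order.disp_t) (G : lgroupType d) (u : G).
Implicit Types (f g s : G) (T : nat -> nat -> G) (Y : set (G -> R)).
Local Open Scope classical_set_scope.
Local Open Scope quotient_scope.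

Definition null_set Y := exists T, forall x, Y x -> ~ respects u T x.

Lemma respects_rows T T' (x : G -> R) :
  (forall i, exists j, T' j = T i) -> respects u T' x -> respects u T x.
Proof.
move=> TT' [xu xops xlub]; split=> //.
  move=> i j k l; have [i' <-] := TT' i; have [k' <-] := TT' k.
  exact: xops.
by move=> i; have [i' <-] := TT' i; exact: xlub.
Qed.

Lemma null_set0 : null_set set0.
Proof. by exists (fun _ _ => 1%g). Qed.

Lemma null_setS Y Y' : Y `<=` Y' -> null_set Y' -> null_set Y.
Proof. by move=> YY' [T T0]; exists T => x /YY'; exact: T0. Qed.

Lemma null_set_bigcup (F : nat -> set (G -> R)) :
  (forall n, null_set (F n)) -> null_set (\bigcup_n F n).
Proof.
move=> /choice[T TF].
exists (fun m => if unpickle m is Some (n, i) then T n i else fun=> 1%g).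
move=> x [n _ Fx] /respects_rows Tx; apply: (TF n x Fx); apply: Tx => i.
by exists (pickle (n, i)); rewrite pickleK.
Qed.

Definition null_ideal := SigmaIdeal null_set0 null_setS null_set_bigcup.
Local Notation Q := (real_quotient R null_ideal).

(** * The evaluation map *)

Definition evaluation f : Q := \pi_Q (fun x => x f).

Lemma null_ideal_respects T : null_ideal [set x | ~ respects u T x].
Proof. by exists T => x. Qed.

Definition pair_rows f g (i j : nat) := if i is 0 then f else g.

Lemma evaluation_mul : {morph evaluation : f g / (f * g)%g}.
Proof.
move=> f g; rewrite /evaluation -Defs.pi_mul; apply/pi_eqP.
apply: sigma_idealS (null_ideal_respects (pair_rows f g)) => x /= xfg.
by move=> [_ /(_ 0 0 1 0)[xM _ _] _]; apply: xfg.
Qed.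

Lemma evaluation_meet : Order.meet_morphism evaluation.
Proof.
move=> f g; rewrite /evaluation -Defs.pi_meet; apply/pi_eqP.
apply: sigma_idealS (null_ideal_respects (pair_rows f g)) => x /= xfg.
by move=> [_ /(_ 0 0 1 0)[_ xI _] _]; apply: xfg.
Qed.

Lemma evaluation_join : Order.join_morphism evaluation.
Proof.
move=> f g; rewrite /evaluation -Defs.pi_join; apply/pi_eqP.
apply: sigma_idealS (null_ideal_respects (pair_rows f g)) => x /= xfg.
by move=> [_ /(_ 0 0 1 0)[_ _ xU] _]; apply: xfg.
Qed.

Lemma evaluation_unit : evaluation u = \pi_Q (fun=> 1%R).
Proof.
apply/pi_eqP; apply: sigma_idealS (null_ideal_respects (fun _ _ => 1%g)).
by move=> x /= xu [].
Qed.

Lemma evaluation_sigma_continuous : sigma_continuous evaluation.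
Proof.
move=> A s /pfcard_geP[-> [//]|[a] _ lubs].
have rA : range a = A by exact: image_eq.
rewrite -rA in lubs *.
have nullT := null_ideal_respects (fun=> a).
split.
  move=> _ [_ [n _ <-] <-]; apply/pi_leP; apply: sigma_idealS nullT => x /= xas.
  by move=> [_ _ /(_ 0 s lubs)[ub _]]; apply: xas; apply: ub; exists n.
elim/quotW => h hub; apply/pi_leP.
(* Each of these countably many exceptional sets is null, hence so is their union; outside it [h x]
   bounds all [x (a n)]. *)
have nullh n : null_ideal [set x | ~ (x (a n) <= h x)%R].
  by apply/pi_leP; apply: hub; exists (a n) => //; exists n.
apply: sigma_idealS (sigma_idealU nullT (sigma_ideal_bigcup nullh)) => x /= xs.
have [Tx|] := pselect (respects u (fun=> a) x); [right|by left].
apply: contrapT => xh; apply: xs; have [_ _ /(_ 0 s lubs)[_ lub]] := Tx.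
apply: lub => _ [n _ <-] /=; apply: contrapT => xn; apply: xh.
by exists n.
Qed.

(** Comparing [f] and [g] with their join reduces to [f <= g]. If [f] and [g] differ, [c = g * f^-1]
    is above [1]; a table witnessing that [x c <> 0] is exceptional is refuted by a generic
    function. *)
Lemma evaluation_inj :
  archimedean_lgroup G -> weak_unit u -> injective evaluation.
Proof.
move=> arch wu.
have le_inj f g : (f <= g)%O -> evaluation f = evaluation g -> f = g.
  move=> fg efg; apply/eqP/negPn/negP => nfg.
  have c1 : (1 < g * f^-1)%g%O.
    rewrite lt_def lgroup_div1le fg andbT.
    by apply/negP => /eqP/divg1_eq gf; rewrite gf eqxx in nfg.
  have : evaluation (g * f^-1)%g = 1%g.
    by apply: (@mulIg _ (evaluation f)); rewrite -evaluation_mul mulgVK mul1g.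
  rewrite -Defs.pi_one => /pi_eqP[T nT].
  by have [x Tx xc] := @respects_generic _ _ R _ T _ arch wu c1; exact: nT Tx.
move=> f g efg; transitivity (f `|` g)%O.
  by apply: le_inj; rewrite ?leUl// evaluation_join efg joinxx.
by apply/esym/le_inj; rewrite ?leUr// evaluation_join efg joinxx.
Qed.

End NullIdeal.

Theorem theorem11p3 (R : realType) (d : Order.disp_t) (G : lgroupType d)
    (u : G) (sigmaG : dedekind_sigma_complete G) (wu : weak_unit u) :
  exists (X : Type) (I : sigma_ideal X) (iota : G -> real_quotient R I),
    [/\ injective iota,
        sigma_continuous iota,
        lgroup_morphism iota &
        iota u = (\pi_(real_quotient R I) (fun _ : X => 1%R))%qT].
Proof.
exists (G -> R), (null_ideal R u), (@evaluation R d G u); split.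
- exact/evaluation_inj/wu/dedekind_sigma_complete_archimedean.
- exact: evaluation_sigma_continuous.
- split; [exact: evaluation_mul|exact: evaluation_meet|].
  exact: evaluation_join.
- exact: evaluation_unit.
Qed.
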